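(* For every transitive tournament $T$ of order $n$, $\gamma^+_{maj}(T)=-n+2\lceil \frac{n+2}{4}\rceil$.
   Context: A tournament is an orientation of a complete graph (each pair of distinct vertices joined by exactly one arc). A digraph $D=(V,A)$ is transitive if $uv\in A$ and $vw\in A$ imply $uw\in A$ for all $u,v,w\in V$. For $u\in V$, $N^+[u]=\{u\}\cup\{v: uv\in A\}$. For $f:V\to\{-1,1\}$ and $X\subseteq V$, $f(X)=\sum_{v\in X}f(v)$. A majority out-dominating function (MODF) of $D$ is a function $f:V\to\{-1,1\}$ with $|\{v\in V: f(N^+[v])\geq1\}|\geq |V|/2$; its weight is $w(f)=f(V)$. $\gamma^+_{maj}(D)$ is the minimum weight of a MODF of $D$. *)

(* Defs.v *)
From mathcomp Require Import all_boot all_order all_algebra.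

Set Implicit Arguments.
Unset Strict Implicit.
Unset Printing Implicit Defensive.

Import Order.TTheory GRing.Theory Num.Theory.
Local Open Scope ring_scope.

(* A digraph is a finType of vertices V with its arc relation A : rel V. *)

Definition tournament (V : finType) (A : rel V) : Prop :=
  irreflexive A /\ forall u v : V, u != v -> A u v (+) A v u.

Definition closed_out_nbhd (V : finType) (A : rel V) (u : V) : {set V} :=
  u |: [set v | A u v].

Notation pm1 := (seq_sub [:: (-1 : int); 1]).

Definition fsum (V : finType) (f : {ffun V -> pm1}) (X : {set V}) : int :=
  \sum_(v in X) val (f v).

Definition weight (V : finType) (f : {ffun V -> pm1}) : int := fsum f [set: V].

Definition modf (V : finType) (A : rel V) (f : {ffun V -> pm1}) : bool :=
  #|V|%:R / 2 <= #|[set v | 1 <= fsum f (closed_out_nbhd A v)]|%:R :> rat.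

Definition ones (V : finType) : {ffun V -> pm1} :=
  [ffun=> SeqSub (isT : 1 \in [:: (-1 : int); 1])].

(* [ones V] only shows that the set of MODFs is nonempty, see [modf_ones]. *)
Definition gamma_maj (V : finType) (A : rel V) : int :=
  weight [arg min_(f < ones V | modf A f) weight f]%O.

Lemma modf_ones (V : finType) (A : rel V) : modf A (ones V).
Proof.
rewrite /modf; set S := [set v | _].
have -> : S = setT.
  apply/setP => v; rewrite !inE /fsum (bigD1 v) ?inE ?eqxx //= ffunE /=.
  by rewrite lerDl sumr_ge0 // => i _; rewrite ffunE.
by rewrite cardsT ler_pdivrMr // ler_peMr // ler1n.
Qed.

Lemma gamma_majP (V : finType) (A : rel V) :
  (exists2 f, modf A f & weight f = gamma_maj A) /\
  (forall f, modf A f -> gamma_maj A <= weight f).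
Proof.
rewrite /gamma_maj; case: arg_minP; first exact: modf_ones.
by move=> f fM f_min; split; first by exists f.
Qed.

(* Main.v *)
(* In a transitive tournament the closed out-neighbourhoods form a chain
   N_1 < ... < N_n with #|N_k| = k, so f(N_k) is the k-th partial sum of f
   along the order that starts at the sink.
   Lower bound: if N_k is the largest neighbourhood with f(N_k) >= 1, it
   contains the at least n/2 vertices counted by the majority condition, so it
   has at least (n/2 + 1)/2 vertices of value 1.
   Upper bound: giving value 1 to exactly the p = ceil((n+2)/4) vertices of N_p
   makes f(N_k) >= 1 for all k <= 2p - 1, and 2p - 1 >= n/2. *)
Require Import Defs.
From mathcomp Require Import all_boot all_order all_algebra.
From mathcomp Require Import zify.

Set Implicit Arguments.
Unset Strict Implicit.
Unset Printing Implicit Defensive.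

Import Order.TTheory GRing.Theory Num.Theory.
Local Open Scope ring_scope.

Section SignedFunctions.

Variable V : finType.

Definition positives (f : {ffun V -> pm1}) : {set V} :=
  [set v | val (f v) == 1].

Definition sign_of (P : {set V}) : {ffun V -> pm1} :=
  [ffun v => if v \in P then SeqSub (isT : 1 \in [:: (-1 : int); 1])
             else SeqSub (isT : -1 \in [:: (-1 : int); 1])].

Lemma positives_sign_of (P : {set V}) : positives (sign_of P) = P.
Proof. by apply/setP => v; rewrite inE ffunE; case: (v \in P). Qed.

(** A value in {-1, 1} is twice the indicator of being 1, minus one. This turns every sum into
    cardinalities, so the final inequalities are left to [lia]. *)
Lemma fsumE (f : {ffun V -> pm1}) (X : {set V}) :
  fsum f X = 2 * #|X :&: positives f|%:Z - #|X|%:Z.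
Proof.
have val_f v : val (f v) = 2 * (v \in positives f)%:R - 1.
  rewrite inE; have := valP (f v); rewrite !inE.
  by case/orP => /eqP ->.
rewrite /fsum (eq_bigr _ (fun v _ => val_f v)) sumrB -mulr_sumr sumr_const.
rewrite -natr_sum !natz; congr (_ * Posz _ - _).
rewrite -sum1_card big_mkcond [RHS]big_mkcond /=.
by apply: eq_bigr => v _; rewrite in_setI; case: (v \in X); case: (v \in _).
Qed.

Lemma weightE (f : {ffun V -> pm1}) :
  weight f = - #|V|%:Z + 2 * #|positives f|%:Z.
Proof. by rewrite /weight fsumE setTI cardsT addrC. Qed.

Lemma modfE (A : rel V) (f : {ffun V -> pm1}) :
  modf A f =
  (#|V| <= 2 * #|[set v | (1 <= fsum f (closed_out_nbhd A v))%R]|)%N.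
Proof. by rewrite /modf ler_pdivrMr // -natrM ler_nat mulnC. Qed.

End SignedFunctions.

Section TransitiveTournament.

Variables (V : finType) (A : rel V).
Hypotheses (tourA : tournament A) (transA : transitive A).

Let N := closed_out_nbhd A.

(** An arc from x to y makes [N y] a proper subset of [N x]: transitivity gives inclusion, and x
    itself is missed by irreflexivity. Hence [#|N v|] can serve as the rank of v, counted from the
    sink. *)
Lemma mem_closed_out_nbhd (u v : V) : (v \in N u) = (#|N v| <= #|N u|)%N.
Proof.
case: tourA => irrA totA.
have proper_N x y : A x y -> N y \proper N x.
  move=> Axy; apply/properP; split.
    apply/subsetP => z; rewrite !inE => /orP[/eqP ->|Ayz].
      by rewrite Axy orbT.
    by rewrite (transA Axy Ayz) orbT.
  exists x; first by rewrite !inE eqxx.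
  rewrite !inE negb_or; apply/andP; split.
    by apply/eqP => xy; rewrite xy irrA in Axy.
  by apply/negP => /(transA Axy); rewrite irrA.
rewrite !inE; case: (eqVneq v u) => [->|nvu]; first by rewrite leqnn.
have := totA _ _ nvu; case Avu: (A v u); case Auv: (A u v) => // _ /=.
  by rewrite leqNgt proper_card ?proper_N.
by rewrite ltnW // proper_card ?proper_N.
Qed.

Lemma card_closed_out_nbhd_gt0 (v : V) : (0 < #|N v|)%N.
Proof. by apply/card_gt0P; exists v; rewrite mem_closed_out_nbhd. Qed.

(** Two distinct vertices of equal rank would each lie in the other's neighbourhood, giving arcs
    both ways. *)
Lemma card_closed_out_nbhd_inj : injective (fun v => #|N v|).
Proof.
case: tourA => irrA totA u v /= eq_uv; apply/eqP/negPn/negP => nuv.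
have := mem_closed_out_nbhd u v; have := mem_closed_out_nbhd v u.
have := totA _ _ nuv.
rewrite !inE eq_uv leqnn (negPf nuv) eq_sym (negPf nuv) /=.
by move=> Auv Avu_true Auv_true; rewrite Avu_true Auv_true in Auv.
Qed.

(** Ranks are distinct and lie between 1 and [#|V|], so each occurs exactly once; the shift by one
    maps them bijectively onto ['I_#|V|]. *)
Lemma card_closed_out_nbhd_leq (k : nat) :
  (k <= #|V|)%N -> #|[set v | (#|N v| <= k)%N]| = k.
Proof.
move=> le_kV.
have rank_lt v : (#|N v|.-1 < #|V|)%N.
  by rewrite prednK ?card_closed_out_nbhd_gt0 // max_card.
pose rank v : 'I_#|V| := Ordinal (rank_lt v).
have rank_inj : injective rank.
  move=> u v /(congr1 val) /= eq_uv; apply: card_closed_out_nbhd_inj.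
  by move: eq_uv (card_closed_out_nbhd_gt0 u) (card_closed_out_nbhd_gt0 v); lia.
have rank_bij : bijective rank by apply: inj_card_bij; rewrite ?card_ord.
have -> : [set v | (#|N v| <= k)%N] = rank @^-1: [set i : 'I_#|V| | (i < k)%N].
  by apply/setP => v; rewrite !inE /= prednK ?card_closed_out_nbhd_gt0.
rewrite on_card_preimset; last exact: onW_bij.
rewrite -sum1_card (eq_bigl (fun i : 'I__ => (i < k)%N)); last first.
  by move=> i; rewrite inE.
by rewrite (big_ord_narrow le_kV) sum1_card card_ord.
Qed.

Lemma modf_card_positives (f : {ffun V -> pm1}) :
  (0 < #|V|)%N -> modf A f -> (#|V| + 2 <= 4 * #|positives f|)%N.
Proof.
rewrite modfE -/N; set S := [set v | _] => V_gt0 le_VS.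
have [v0 v0S] : exists v, v \in S by apply/card_gt0P; move: V_gt0 le_VS; lia.
case: (arg_maxnP (fun v => #|N v|) v0S) => v vS v_max.
have /subset_leq_card le_SN : S \subset N v.
  by apply/subsetP => w wS; rewrite mem_closed_out_nbhd; exact: v_max.
have le_P : (#|N v :&: positives f| <= #|positives f|)%N.
  exact/subset_leq_card/subsetIr.
(* Writing P for [positives f], 2|P| >= |N v| + 1 >= |S| + 1 and 2|S| >= |V|. *)
by move: (vS : v \in S); rewrite inE fsumE; move: le_SN le_P le_VS; rewrite /N; lia.
Qed.

Lemma modf_sign_of (p : nat) :
  (0 < #|V|)%N -> (p <= #|V|)%N -> (#|V| + 2 <= 4 * p)%N ->
  modf A (sign_of [set v | (#|N v| <= p)%N]).
Proof.
set P := [set v | _] => V_gt0 le_pV le_Vp.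
rewrite modfE -/N; set S := [set v | _].
have P_card : #|P| = p by exact: card_closed_out_nbhd_leq.
(* A vertex of rank k has sum k if k <= p, and 2p - k otherwise, which is at least 1 up to k = 2p -
   1. The cap at [#|V|] is what the counting lemma requires. *)
have /subset_leq_card : [set v | (#|N v| <= minn #|V| (2 * p).-1)%N] \subset S.
  apply/subsetP => v; rewrite !inE fsumE positives_sign_of.
  have Nv_gt0 := card_closed_out_nbhd_gt0 v.
  case: (leqP #|N v| p) => [le_Np _|lt_pN].
    have -> : N v :&: P = N v.
      apply/setIidPl/subsetP => w; rewrite mem_closed_out_nbhd inE => le_wv.
      exact: leq_trans le_wv le_Np.
    by move: Nv_gt0; lia.
  have -> : N v :&: P = P.
    apply/setIidPr/subsetP => w; rewrite mem_closed_out_nbhd inE => le_wp.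
    exact: leq_trans le_wp (ltnW lt_pN).
  by rewrite P_card; move: Nv_gt0; lia.
by rewrite card_closed_out_nbhd_leq ?geq_minl //; move: V_gt0 le_Vp; lia.
Qed.

End TransitiveTournament.

Lemma ceil_add2_div4 (n : nat) :
  Num.ceil ((n%:R + 2) / 4 : rat) = ((n + 5) %/ 4)%:Z.
Proof.
apply: ceil_def; rewrite ltr_pdivlMr // ler_pdivrMr //.
have -> : n%:R + 2 = (n + 2)%N%:Z%:~R :> rat by rewrite -pmulrn natrD.
have -> : 4 = 4%:Z%:~R :> rat by [].
by rewrite -!intrM ltr_int ler_int; lia.
Qed.

Theorem theorem3p4 (n : nat) (V : finType) (A : rel V)
    (n_gt0 : (0 < n)%N) (cardV : #|V| = n)
    (tourA : tournament A) (transA : transitive A) :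
  gamma_maj A = - n%:Z + 2 * Num.ceil ((n%:R + 2) / 4 : rat).
Proof.
rewrite ceil_add2_div4; subst n; set p := ((_ + 5) %/ 4)%N.
have [[f f_modf f_weight] f_min] := gamma_majP A.
(* Positivity of the order matters here: p would be 1 for the empty tournament. *)
have le_pV : (p <= #|V|)%N by rewrite /p; lia.
have le_Vp : (#|V| + 2 <= 4 * p)%N by rewrite /p; lia.
have := f_min _ (modf_sign_of tourA transA n_gt0 le_pV le_Vp).
have {f_min} := modf_card_positives tourA transA n_gt0 f_modf.
(* The bounds meet because p is the least integer with [#|V| + 2 <= 4 * p]. *)
rewrite -f_weight !weightE positives_sign_of card_closed_out_nbhd_leq // /p; lia.
Qed.
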